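(* A regular curve $\gamma(t)=(u(t),v(t))$ in $\mathbb{H}^2_+$ is a hyperbolic catenary (with parameter $\lambda\in\mathbb{R}$) if and only if its curvature $\kappa_h$ satisfies $$\kappa_h=-\frac{1}{d+\lambda}\,\frac{uu'+vv'}{\sqrt{u^2+v^2}\sqrt{u'^2+v'^2}}=-\frac{r'}{(d+\lambda)\sqrt{u'^2+v'^2}},$$ where $r(t)=\sqrt{u(t)^2+v(t)^2}$ and $d=\log\frac{u+r}{v}$.
   Context: $\mathbb{H}^2$ is the upper half-plane $\{(x,y)\in\mathbb{R}^2:y>0\}$ with the metric $g=\frac{dx^2+dy^2}{y^2}$, and $\mathbb{H}^2_+=\{(x,y)\in\mathbb{H}^2:x>0\}$. The function $d=\log\frac{x+\sqrt{x^2+y^2}}{y}$ is, on $\mathbb{H}^2_+$, the hyperbolic distance to the geodesic $L=\{(0,y):y>0\}$. Regular means $\gamma'(t)\neq0$ for all $t$. The potential energy of $\gamma=(u,v)$, $t\in[a,b]$, is $$\mathcal{E}_H[\gamma]=\int_a^b(d+\lambda)\frac{\sqrt{u'^2+v'^2}}{v}\,dt,\qquad d=\log\frac{u+\sqrt{u^2+v^2}}{v},$$ where $\lambda\in\mathbb{R}$ is a constant (a Lagrange multiplier). A hyperbolic catenary is a critical point of $\mathcal{E}_H$ (for variations with fixed endpoints, among curves in $\mathbb{H}^2_+$), i.e. $(u,v)$ satisfies both Euler–Lagrange equations of the integrand. Sign convention: with $m=u'^2+v'^2$, $\kappa_h$ is the geodesic curvature of $\gamma$ in $\mathbb{H}^2$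 with respect to the unit normal $\mathbf{n}=v\frac{(-v',u')}{\sqrt m}$; explicitly $\kappa_h=v\,\frac{u'v''-u''v'}{m^{3/2}}+\frac{u'}{\sqrt m}$. *)

(* Defs.v *)
From Stdlib Require Import Reals.
From Coquelicot Require Import Coquelicot.
Open Scope R_scope.

(** A curve [a,b] -> R^2 is given by two functions u, v : R -> R, of which only
    the restriction to [a,b] matters.  As usual, "C^2 on [a,b]" means C^2 on a
    neighbourhood of [a,b], so that derivatives at the endpoints make sense.
    [ex_derive f] is required separately because [Derive] is total, hence
    differentiability of [Derive f] alone says nothing about [f]. *)
Definition C2_on (a b : R) (f : R -> R) : Prop :=
  forall t, a <= t <= b ->
    locally t (fun x => ex_derive f x /\ ex_derive (Derive f) x /\
                        continuous (Derive (Derive f)) x).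

Definition in_H2plus (x y : R) : Prop := 0 < x /\ 0 < y.

Definition regular_curve (a b : R) (u v : R -> R) : Prop :=
  C2_on a b u /\ C2_on a b v /\
  (forall t, a <= t <= b -> in_H2plus (u t) (v t)) /\
  (forall t, a <= t <= b -> (Derive u t, Derive v t) <> (0, 0)).

(** On H^2_+, the hyperbolic distance from (x,y) to the geodesic {x = 0}. *)
Definition dist_L (x y : R) : R := ln ((x + sqrt (x ^ 2 + y ^ 2)) / y).

Definition speed2 (u v : R -> R) (t : R) : R := Derive u t ^ 2 + Derive v t ^ 2.

Definition energy (lam a b : R) (u v : R -> R) : R :=
  RInt (fun t => (dist_L (u t) (v t) + lam) * (sqrt (speed2 u v t) / v t)) a b.

(** Critical point of the energy under fixed-endpoint variations.  Since [a,b]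
    is compact, (u + s phi, v + s psi) is again a regular curve in H^2_+ for
    all s close to 0, so the derivative at s = 0 only sees curves in H^2_+. *)
Definition hyperbolic_catenary (lam a b : R) (u v : R -> R) : Prop :=
  forall phi psi : R -> R,
    C2_on a b phi -> C2_on a b psi ->
    phi a = 0 -> phi b = 0 -> psi a = 0 -> psi b = 0 ->
    is_derive (fun s => energy lam a b (fun t => u t + s * phi t)
                                       (fun t => v t + s * psi t)) 0 0.

(** Geodesic curvature in H^2 with respect to the unit normal
    v (-v', u') / sqrt (u'^2 + v'^2). *)
Definition kappa_h (u v : R -> R) (t : R) : R :=
  let u' := Derive u t in
  let v' := Derive v t in
  let u'' := Derive (Derive u) t in
  let v'' := Derive (Derive v) t in
  let m := speed2 u v t in
  v t * ((u' * v'' - u'' * v') / sqrt m ^ 3) + u' / sqrt m.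

Definition radius (u v : R -> R) (t : R) : R := sqrt (u t ^ 2 + v t ^ 2).

(* Main.v *)
(* Write [N = (d + lam) kappa_h + r' / |gamma'|].  The Lagrangian is homogeneous of
   degree one in the velocity, so the two Euler-Lagrange expressions are
   [v' N / v^2] and [- u' N / v^2], and a regular curve is a catenary iff [N = 0].
   It remains to divide by [d + lam], which needs care where [d + lam] vanishes,
   because Rocq's [1 / 0 = 0] turns the curvature formula into [kappa_h = 0] there.
   If a catenary reaches [d + lam = 0], the first integral of the dilation symmetry
   vanishes, hence [r' = 0] everywhere: the curve lies on a geodesic orthogonal to [L]
   and [kappa_h = 0].  Conversely, [d + lam] and [kappa_h] cannot both vanish on an
   interval, because equidistant curves of [L] in the open half [x > 0] are not
   geodesics; so the formula implies [N = 0] on a dense set, and everywhere by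
   continuity. *)
Require Import Defs.
From Stdlib Require Import Reals Lra ClassicalEpsilon.
From Coquelicot Require Import Coquelicot.
Open Scope R_scope.

(** * Real analysis on a compact interval *)

Lemma is_derive_continuous (f : R -> R) (x l : R) : is_derive f x l -> continuous f x.
Proof. intros Hf. apply (ex_derive_continuous f). now exists l. Qed.

Lemma Derive_eta (f : R -> R) (x l : R) : is_derive f x l -> Derive (fun y : R => f y) x = l.
Proof. exact (is_derive_unique f x l). Qed.

Lemma locally_continuous_pos {T : UniformSpace} (f : T -> R) (z : T) :
  continuous f z -> 0 < f z -> locally z (fun y => 0 < f y).
Proof.
  intros Hf Hz. apply (Hf (fun y => 0 < y)).
  exact (locally_open (Rlt 0) _ (open_gt 0) (fun _ H => H) _ Hz).
Qed.

(** Otherwise [h * h] would stay positive on a neighbourhood of [t], which would then contain no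
    zero. *)
Lemma continuous_eq0_limit (h : R -> R) (t : R) :
  continuous h t ->
  (forall eps, 0 < eps -> exists x, Rabs (x - t) < eps /\ h x = 0) -> h t = 0.
Proof.
  intros Hc Hz. apply NNPP. intros Hne.
  assert (Hloc : locally t (fun x => 0 < h x * h x)).
  { apply locally_continuous_pos; [exact (continuous_mult h h t Hc Hc) | nra]. }
  destruct Hloc as [eps Heps].
  destruct (Hz eps (cond_pos eps)) as [x [Hx Hx0]].
  specialize (Heps x Hx). simpl in Heps. rewrite Hx0 in Heps. lra.
Qed.

(** Supplies an interval of positive length inside [[a, b]] even when [t] is an endpoint, where a
    symmetric neighbourhood would leave [[a, b]]. *)
Lemma interval_near (a b t eps : R) :
  a < b -> a <= t <= b -> 0 < eps ->
  exists c d, a <= c /\ c < d /\ d <= b /\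
    forall x, c <= x <= d -> Rabs (x - t) < eps.
Proof.
  intros Hab Ht He. exists (Rmax a (t - eps / 2)), (Rmin b (t + eps / 2)).
  split; [apply Rmax_l|]. split; [|split; [apply Rmin_l|]].
  - apply Rmax_lub_lt; apply Rmin_glb_lt; lra.
  - intros x [H1 H2].
    pose proof (Rmax_r a (t - eps / 2)). pose proof (Rmin_r b (t + eps / 2)).
    apply Rabs_def1; lra.
Qed.

Lemma continuous_eq0_closure (h : R -> R) (a b : R) :
  a < b -> (forall t, a <= t <= b -> continuous h t) ->
  (forall t, a < t < b -> h t = 0) -> forall t, a <= t <= b -> h t = 0.
Proof.
  intros Hab Hc Hz t Ht. apply continuous_eq0_limit; [now apply Hc|].
  intros eps He. destruct (interval_near a b t eps Hab Ht He) as (c & d & H1 & H2 & H3 & H4).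
  exists ((c + d) / 2). split; [apply H4; lra | apply Hz; lra].
Qed.

Lemma ex_RInt_continuous_le (h : R -> R) (a b : R) :
  a <= b -> (forall t, a <= t <= b -> continuous h t) -> ex_RInt h a b.
Proof.
  intros Hab Hc. apply (ex_RInt_continuous (V := R_CompleteNormedModule)). intros z.
  rewrite Rmin_left, Rmax_right by exact Hab. apply Hc.
Qed.

(** A positive value persists on some [[c, d]] and makes the integral over it positive, while the
    two remaining pieces contribute nonnegative integrals. *)
Lemma RInt_nonneg_eq0 (h : R -> R) (a b : R) :
  a < b -> (forall t, a <= t <= b -> continuous h t) ->
  (forall t, a <= t <= b -> 0 <= h t) -> RInt h a b = 0 ->
  forall t, a <= t <= b -> h t = 0.
Proof.
  intros Hab Hc Hpos Hint t Ht. apply NNPP. intros Hne.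
  assert (Hht : 0 < h t) by (specialize (Hpos t Ht); lra).
  destruct (locally_continuous_pos h t (Hc t Ht) Hht) as [eps Heps].
  destruct (interval_near a b t eps Hab Ht (cond_pos eps)) as (c & d & H1 & H2 & H3 & H4).
  assert (Hex : forall x y, a <= x -> x <= y -> y <= b -> ex_RInt h x y).
  { intros x y Hx Hxy Hy. apply ex_RInt_continuous_le; [exact Hxy|].
    intros z Hz. apply Hc. lra. }
  pose proof (RInt_Chasles h a c d (Hex a c ltac:(lra) ltac:(lra) ltac:(lra))
    (Hex c d ltac:(lra) ltac:(lra) ltac:(lra))) as E1.
  pose proof (RInt_Chasles h a d b (Hex a d ltac:(lra) ltac:(lra) ltac:(lra))
    (Hex d b ltac:(lra) ltac:(lra) ltac:(lra))) as E2.
  assert (I1 : 0 <= RInt h a c).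
  { apply RInt_ge_0; [lra | apply Hex; lra | intros; apply Hpos; lra]. }
  assert (I2 : 0 < RInt h c d).
  { apply RInt_gt_0; [lra | | intros; apply Hc; lra].
    intros x Hx. apply Heps. apply H4. lra. }
  assert (I3 : 0 <= RInt h d b).
  { apply RInt_ge_0; [lra | apply Hex; lra | intros; apply Hpos; lra]. }
  unfold plus in E1, E2; simpl in E1, E2. lra.
Qed.

(** Serves to differentiate identities valid on an open interval: [p = 0] in the fundamental lemma,
    then orthogonality, constancy of the distance, and the ray relation. *)
Lemma is_derive_locally0 (f : R -> R) (a b t l : R) :
  (forall x, a < x < b -> f x = 0) -> a < t < b -> is_derive f t l -> l = 0.
Proof.
  intros Hf Ht Hl. rewrite <- (is_derive_unique _ _ _ Hl). apply is_derive_unique.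
  apply (is_derive_ext_loc (fun _ => 0)); [|exact (is_derive_const 0 t)].
  apply (locally_open (fun x => a < x /\ x < b)); [|intros x Hx; symmetry; now apply Hf | exact Ht].
  apply open_and; [apply open_gt | apply open_lt].
Qed.

(** * Tools of the calculus of variations: the fundamental lemma and uniformity in the parameter *)

Lemma is_derive_RInt_global (f : R -> R) (a x : R) :
  (forall t, continuous f t) -> is_derive (fun y => RInt f a y) x (f x).
Proof.
  intros Hf. apply (is_derive_RInt f (fun y => RInt f a y) a x); [|apply Hf].
  apply filter_forall. intros y. apply (RInt_correct f a y).
  apply (ex_RInt_continuous (V := R_CompleteNormedModule)). intros; apply Hf.
Qed.

(* Testing against the solution of [phi'' = g], [phi a = phi b = 0], gives
   [int phi'^2 = 0] after integration by parts, so no bump functions are needed. *)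
Lemma fundamental_lemma_C2 (a b : R) (g : R -> R) :
  a < b -> (forall t, a <= t <= b -> continuous g t) ->
  (forall phi, C2_on a b phi -> phi a = 0 -> phi b = 0 ->
     RInt (fun t => g t * phi t) a b = 0) ->
  forall t, a <= t <= b -> g t = 0.
Proof.
  intros Hab Hg Hphi.
  (* [g] is continuous only at points of [[a, b]]; the extension [g1] is continuous everywhere, so
     its primitives are differentiable on the whole line and [phi] is C^2 near the endpoints too. *)
  destruct (C0_extension_le g a b Hg) as [g1 [Hg1 Heq]].
  assert (Hc1 : forall t, continuous g1 t) by exact Hg1.
  set (G := fun x : R => RInt g1 a x : R).
  assert (HG : forall x, is_derive G x (g1 x)).
  { intros x. now apply is_derive_RInt_global. }
  assert (HGc : forall x, continuous G x).
  { intros x. exact (is_derive_continuous _ _ _ (HG x)). }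
  set (H := fun x : R => RInt G a x : R).
  assert (HH : forall x, is_derive H x (G x)).
  { intros x. now apply is_derive_RInt_global. }
  (* As [H a = 0], subtracting the linear term of slope [k] makes [phi] vanish at both ends and
     keeps its second derivative [g1]. *)
  set (k := H b / (b - a)).
  set (phi := fun x => H x - k * (x - a)).
  set (p := fun x => G x - k).
  assert (Dphi : forall x, is_derive phi x (p x)).
  { intros x. unfold phi, p.
    auto_derive; [exists (G x); apply HH | rewrite (Derive_eta _ _ _ (HH x)); ring]. }
  assert (Dp : forall x, is_derive p x (g1 x)).
  { intros x. unfold p.
    auto_derive; [exists (g1 x); apply HG | rewrite (Derive_eta _ _ _ (HG x)); ring]. }
  assert (Ephi : forall x, Derive phi x = p x) by (intros; now apply is_derive_unique).
  assert (DDphi : forall x, is_derive (Derive phi) x (g1 x)).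
  { intros x. apply (is_derive_ext p); [now intros; symmetry | apply Dp]. }
  assert (HC2 : C2_on a b phi).
  { intros t _. apply filter_forall. intros x. split; [eexists; apply Dphi|].
    split; [eexists; apply DDphi|].
    apply (continuous_ext g1); [intros; symmetry; now apply is_derive_unique | apply Hc1]. }
  assert (H0 : phi a = 0).
  { unfold phi, H. rewrite RInt_point. unfold zero; simpl. ring. }
  assert (H1 : phi b = 0) by (unfold phi, k; field; lra).
  assert (Hpc : forall x, continuous p x).
  { intros x. exact (is_derive_continuous _ _ _ (Dp x)). }
  assert (Hfc : forall x, continuous phi x).
  { intros x. exact (is_derive_continuous _ _ _ (Dphi x)). }
  (* Integration by parts: the integrand is the derivative of [p * phi], whose boundary values
     vanish. Its [g1 * phi] part integrates to zero by hypothesis, hence so does [p * p]. *)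
  assert (I1 : is_RInt (fun x => g1 x * phi x + p x * p x) a b
                 (minus (p b * phi b) (p a * phi a))).
  { apply (is_RInt_derive (fun x => p x * phi x)); intros x _.
    - auto_derive; [split; [eexists; apply Dp | split; [eexists; apply Dphi | exact I]]|].
      rewrite (Derive_eta _ _ _ (Dp x)), (Derive_eta _ _ _ (Dphi x)). ring.
    - apply (continuous_plus (fun x => g1 x * phi x) (fun x => p x * p x)).
      + apply (continuous_mult g1 phi); auto.
      + apply (continuous_mult p p); auto. }
  assert (I2 : is_RInt (fun x => g1 x * phi x) a b 0).
  { rewrite <- (Hphi phi HC2 H0 H1).
    apply (is_RInt_ext (fun t => g t * phi t)).
    - intros x. rewrite Rmin_left, Rmax_right by lra. intros Hx. rewrite Heq by lra. reflexivity.
    - apply (RInt_correct (fun t => g t * phi t)).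
      apply ex_RInt_continuous_le; [lra|]. intros t Ht.
      apply (continuous_mult g phi); auto. }
  assert (I3 : RInt (fun x => p x * p x) a b = 0).
  { apply is_RInt_unique.
    pose proof (is_RInt_minus _ _ _ _ _ _ I1 I2) as I3.
    replace 0 with (minus (minus (p b * phi b) (p a * phi a)) 0)
      by (rewrite H0, H1; unfold minus, plus, opp; simpl; ring).
    refine (is_RInt_ext _ _ _ _ _ _ I3).
    intros x _. unfold minus, plus, opp; simpl. ring. }
  assert (Hp0 : forall t, a <= t <= b -> p t = 0).
  { intros t Ht. assert (p t * p t = 0); [|nra].
    refine (RInt_nonneg_eq0 (fun x => p x * p x) a b Hab _ _ I3 t Ht).
    - intros x _. apply (continuous_mult p p); auto.
    - intros x _. nra. }
  apply continuous_eq0_closure; [exact Hab | exact Hg|].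
  intros t Ht. rewrite <- (Heq t) by lra.
  apply (is_derive_locally0 p a b t); [intros; apply Hp0; lra | exact Ht | apply Dp].
Qed.

(** The tube lemma: compactness of [[a, b]] yields one radius in [s] valid for every [t]. It makes
    the perturbed curves admissible for all small [s]. *)
Lemma locally_2d_tube (P : R -> R -> Prop) (x a b : R) :
  (forall t, a <= t <= b -> locally_2d P x t) ->
  locally x (fun s => forall t, a <= t <= b -> P s t).
Proof.
  intros HP.
  assert (Hd : forall t, exists delta : posreal, a <= t <= b ->
    forall s y, Rabs (s - x) < delta -> Rabs (y - t) < delta -> P s y).
  { intros t. destruct (excluded_middle_informative (a <= t <= b)) as [Ht|Ht].
    - destruct (HP t Ht) as [delta Hdelta]. exists delta. intros _. exact Hdelta.
    - exists (mkposreal 1 Rlt_0_1). tauto. }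
  (* The covering lemma takes a total function of radii, so one is chosen for every [t], with the
     arbitrary value 1 allowed outside [[a, b]]. *)
  set (delta := fun t => proj1_sig (constructive_indefinite_description _ (Hd t))).
  assert (Hdelta : forall t, a <= t <= b ->
    forall s y, Rabs (s - x) < delta t -> Rabs (y - t) < delta t -> P s y).
  { intros t. unfold delta. now destruct (constructive_indefinite_description _ (Hd t)). }
  destruct (compactness_value_1d a b delta) as [d Hcov].
  exists d. intros s Hs t Ht. apply NNPP. intros Hn. apply (Hcov t Ht).
  intros (t0 & Ht0 & H1 & H2). apply Hn. apply (Hdelta t0 Ht0); [|exact H1].
  apply Rlt_le_trans with (1 := Hs). exact H2.
Qed.

(** * The Lagrangian, its partial derivatives and the Euler-Lagrange expressions *)

Lemma dist_L_arg_pos (x y : R) : 0 < x -> 0 < y -> 0 < (x + sqrt (x ^ 2 + y ^ 2)) / y.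
Proof.
  intros Hx Hy. apply Rdiv_lt_0_compat; [|exact Hy].
  pose proof (sqrt_pos (x ^ 2 + y ^ 2)). lra.
Qed.

Lemma sqrt_pos_spec (x : R) : 0 < x -> 0 < sqrt x /\ sqrt x ^ 2 = x.
Proof. intros Hx. split; [now apply sqrt_lt_R0 | apply pow2_sqrt; lra]. Qed.

(** For [y > 0] the distance is arsinh of [x / y]; its derivative, [(x / y)'] over
    [sqrt (1 + (x / y) ^ 2)], simplifies to this form. *)
Lemma is_derive_dist_L (x y : R -> R) (t dx dy : R) :
  is_derive x t dx -> is_derive y t dy -> 0 < x t -> 0 < y t ->
  is_derive (fun s => dist_L (x s) (y s)) t
    ((dx - x t / y t * dy) / sqrt (x t ^ 2 + y t ^ 2)).
Proof.
  intros Dx Dy Hx Hy. unfold dist_L.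
  destruct (sqrt_pos_spec (x t ^ 2 + y t ^ 2)) as [Hr Hrr]; [nra|].
  pose proof (dist_L_arg_pos _ _ Hx Hy) as Harg.
  auto_derive.
  - repeat split; first [now eexists; eassumption | exact Harg | assumption | lra | nra].
  - rewrite (Derive_eta _ _ _ Dx), (Derive_eta _ _ _ Dy).
    set (r := sqrt (x t ^ 2 + y t ^ 2)) in *.
    change (sqrt (x t * (x t * 1) + y t * (y t * 1))) with r.
    field [Hrr]. repeat split; lra.
Qed.

Definition lagrangian (lam x y p q : R) : R :=
  (dist_L x y + lam) * (sqrt (p ^ 2 + q ^ 2) / y).

(** This and the next three functions are closed forms of the partial derivatives of [lagrangian];
    the last two are the momenta conjugate to [x] and [y]. *)
Definition lagrangian_x (x y p q : R) : R :=
  sqrt (p ^ 2 + q ^ 2) / (y * sqrt (x ^ 2 + y ^ 2)).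

Definition lagrangian_y (lam x y p q : R) : R :=
  - (x / sqrt (x ^ 2 + y ^ 2) + (dist_L x y + lam)) * sqrt (p ^ 2 + q ^ 2) / y ^ 2.

Definition lagrangian_p (lam x y p q : R) : R :=
  (dist_L x y + lam) * p / (y * sqrt (p ^ 2 + q ^ 2)).

Definition lagrangian_q (lam x y p q : R) : R :=
  (dist_L x y + lam) * q / (y * sqrt (p ^ 2 + q ^ 2)).

(** The chain rule along a curve certifies all four closed forms at once; it is applied later with
    the variation parameter as the variable. *)
Lemma is_derive_lagrangian (lam : R) (x y p q : R -> R) (t dx dy dp dq : R) :
  is_derive x t dx -> is_derive y t dy -> is_derive p t dp -> is_derive q t dq ->
  0 < x t -> 0 < y t -> 0 < p t ^ 2 + q t ^ 2 ->
  is_derive (fun s => lagrangian lam (x s) (y s) (p s) (q s)) t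
    (lagrangian_x (x t) (y t) (p t) (q t) * dx +
     lagrangian_y lam (x t) (y t) (p t) (q t) * dy +
     lagrangian_p lam (x t) (y t) (p t) (q t) * dp +
     lagrangian_q lam (x t) (y t) (p t) (q t) * dq).
Proof.
  intros Dx Dy Dp Dq Hx Hy Hm. unfold lagrangian.
  (* Naming the distance, with its derivative already known, keeps the logarithm out of the [field]
     computation. *)
  set (D := fun s => dist_L (x s) (y s)).
  pose proof (is_derive_dist_L x y t dx dy Dx Dy Hx Hy : is_derive D t _) as DD.
  change (is_derive (fun s => (D s + lam) * (sqrt (p s ^ 2 + q s ^ 2) / y s)) t
    (lagrangian_x (x t) (y t) (p t) (q t) * dx +
     lagrangian_y lam (x t) (y t) (p t) (q t) * dy +
     lagrangian_p lam (x t) (y t) (p t) (q t) * dp +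
     lagrangian_q lam (x t) (y t) (p t) (q t) * dq)).
  unfold lagrangian_x, lagrangian_y, lagrangian_p, lagrangian_q.
  change (dist_L (x t) (y t)) with (D t).
  destruct (sqrt_pos_spec (x t ^ 2 + y t ^ 2)) as [Hr Hrr]; [nra|].
  destruct (sqrt_pos_spec _ Hm) as [Hs Hss].
  auto_derive.
  - repeat split; first [now eexists; eassumption | assumption | lra | nra].
  - rewrite (Derive_eta _ _ _ Dy), (Derive_eta _ _ _ Dp),
      (Derive_eta _ _ _ Dq), (Derive_eta _ _ _ DD).
    set (r := sqrt (x t ^ 2 + y t ^ 2)) in *.
    set (s := sqrt (p t ^ 2 + q t ^ 2)) in *.
    change (sqrt (p t * (p t * 1) + q t * (q t * 1))) with s.
    field [Hss]. repeat split; lra.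
Qed.

(* The normal component of the Euler-Lagrange equations, cleared of the
   denominator [dist_L + lam]. *)
Definition catenary_defect (lam : R) (u v : R -> R) (t : R) : R :=
  (dist_L (u t) (v t) + lam) * kappa_h u v t +
  (u t * Derive u t + v t * Derive v t) / (radius u v t * sqrt (speed2 u v t)).

Definition along (f : R -> R -> R -> R -> R) (u v : R -> R) (t : R) : R :=
  f (u t) (v t) (Derive u t) (Derive v t).

(** Degree-one homogeneity leaves only a normal component, so a single defect governs both
    equations. Written as derivatives of the momenta, they feed the integration by parts in the
    first variation and the conservation law for dilations. *)
Lemma euler_lagrange_pq (lam : R) (u v : R -> R) (t : R) :
  ex_derive u t -> ex_derive v t -> ex_derive (Derive u) t -> ex_derive (Derive v) t ->
  0 < u t -> 0 < v t -> 0 < speed2 u v t ->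
  is_derive (along (lagrangian_p lam) u v) t
    (along lagrangian_x u v t - Derive v t / v t ^ 2 * catenary_defect lam u v t) /\
  is_derive (along (lagrangian_q lam) u v) t
    (along (lagrangian_y lam) u v t + Derive u t / v t ^ 2 * catenary_defect lam u v t).
Proof.
  unfold along, lagrangian_p, lagrangian_q, lagrangian_x, lagrangian_y, catenary_defect,
    kappa_h, radius, speed2.
  intros Eu Ev Ep Eq Hu Hv Hm.
  apply Derive_correct in Eu, Ev.
  set (D := fun s => dist_L (u s) (v s)).
  pose proof (is_derive_dist_L u v t _ _ Eu Ev Hu Hv : is_derive D t _) as DD.
  change (dist_L (u t) (v t)) with (D t).
  destruct (sqrt_pos_spec (u t ^ 2 + v t ^ 2)) as [Hr Hrr]; [nra|].
  destruct (sqrt_pos_spec _ Hm) as [Hs Hss].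
  set (p := Derive u) in *. set (q := Derive v) in *.
  split;
    [ apply (is_derive_ext (fun t => (D t + lam) * p t / (v t * sqrt (p t ^ 2 + q t ^ 2))))
    | apply (is_derive_ext (fun t => (D t + lam) * q t / (v t * sqrt (p t ^ 2 + q t ^ 2)))) ];
    try reflexivity.
  all: auto_derive;
    [ repeat split; try first [now eexists; eassumption | assumption | lra];
      apply Rgt_not_eq, Rmult_lt_0_compat; assumption | ].
  all: rewrite (Derive_eta _ _ _ Ev), (Derive_eta _ _ _ DD).
  all: change (Derive (fun x => p x) t) with (Derive p t);
    change (Derive (fun x => q x) t) with (Derive q t).
  all: set (r := sqrt (u t ^ 2 + v t ^ 2)) in *; set (s := sqrt (p t ^ 2 + q t ^ 2)) in *;
    change (sqrt (p t * (p t * 1) + q t * (q t * 1))) with s.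
  (* Given [s ^ 2 = p ^ 2 + q ^ 2], both claims are identities of rational functions. *)
  all: field [Hss]; repeat split; lra.
Qed.

(** * Continuity of the Lagrangian and of its partial derivatives *)

Section Continuity.
Context {T : UniformSpace}.
Implicit Types (f g : T -> R) (z : T).

Lemma continuous_Rplus f g z :
  continuous f z -> continuous g z -> continuous (fun w => f w + g w) z.
Proof. exact (continuous_plus f g z). Qed.

Lemma continuous_Rminus f g z :
  continuous f z -> continuous g z -> continuous (fun w => f w - g w) z.
Proof. exact (continuous_minus f g z). Qed.

Lemma continuous_Ropp f z : continuous f z -> continuous (fun w => - f w) z.
Proof. exact (continuous_opp f z). Qed.

Lemma continuous_Rmult f g z :
  continuous f z -> continuous g z -> continuous (fun w => f w * g w) z.
Proof. exact (continuous_mult f g z). Qed.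

Lemma continuous_Rpow f n z : continuous f z -> continuous (fun w => f w ^ n) z.
Proof.
  intros Hf. induction n as [|n IH]; simpl; [apply continuous_const|].
  now apply continuous_Rmult.
Qed.

Lemma continuous_Rdiv f g z :
  continuous f z -> continuous g z -> g z <> 0 -> continuous (fun w => f w / g w) z.
Proof.
  intros Hf Hg Hz. apply continuous_Rmult; [exact Hf|].
  apply (continuous_comp g Rinv); [exact Hg | now apply continuous_Rinv].
Qed.

Lemma continuous_Rsqrt f z : continuous f z -> continuous (fun w => sqrt (f w)) z.
Proof. intros Hf. apply (continuous_comp f sqrt); [exact Hf | apply continuous_sqrt]. Qed.

Lemma continuous_dist_L f g z :
  continuous f z -> continuous g z -> 0 < f z -> 0 < g z ->
  continuous (fun w => dist_L (f w) (g w)) z.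
Proof.
  intros Hf Hg Hfz Hgz. unfold dist_L.
  apply (continuous_comp (fun w => (f w + sqrt (f w ^ 2 + g w ^ 2)) / g w) ln).
  - apply continuous_Rdiv; [|exact Hg | lra].
    apply continuous_Rplus; [exact Hf|].
    apply continuous_Rsqrt, continuous_Rplus; now apply continuous_Rpow.
  - apply continuous_ln, dist_L_arg_pos; assumption.
Qed.

End Continuity.

(** Decomposes an expression down to atoms whose continuity is assumed; side goals not found among
    the hypotheses, in practice nonzero denominators, are left open. *)
Ltac continuity_solve :=
  repeat first
    [ assumption
    | lazymatch goal with
      | |- continuous (fun _ => ?c) _ => apply continuous_const
      | |- continuous (fun w => dist_L _ _) _ => apply continuous_dist_L
      | |- continuous (fun w => _ + _) _ => apply continuous_Rplus
      | |- continuous (fun w => _ - _) _ => apply continuous_Rminus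
      | |- continuous (fun w => - _) _ => apply continuous_Ropp
      | |- continuous (fun w => _ / _) _ => apply continuous_Rdiv
      | |- continuous (fun w => _ * _) _ => apply continuous_Rmult
      | |- continuous (fun w => _ ^ _) _ => apply continuous_Rpow
      | |- continuous (fun w => sqrt _) _ => apply continuous_Rsqrt
      end ].

Section LagrangianContinuity.
Context {T : UniformSpace} (lam : R) (x y p q : T -> R) (z : T).

Lemma continuous_lagrangian :
  continuous x z -> continuous y z -> continuous p z -> continuous q z ->
  0 < x z -> 0 < y z ->
  continuous (fun w => lagrangian lam (x w) (y w) (p w) (q w)) z.
Proof. intros. unfold lagrangian. continuity_solve. lra. Qed.

Lemma continuous_lagrangian_partials :
  continuous x z -> continuous y z -> continuous p z -> continuous q z ->
  0 < x z -> 0 < y z -> 0 < p z ^ 2 + q z ^ 2 ->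
  continuous (fun w => lagrangian_x (x w) (y w) (p w) (q w)) z /\
  continuous (fun w => lagrangian_y lam (x w) (y w) (p w) (q w)) z /\
  continuous (fun w => lagrangian_p lam (x w) (y w) (p w) (q w)) z /\
  continuous (fun w => lagrangian_q lam (x w) (y w) (p w) (q w)) z.
Proof.
  intros Cx Cy Cp Cq Hx Hy Hm.
  destruct (sqrt_pos_spec (x z ^ 2 + y z ^ 2)) as [Hr _]; [nra|].
  destruct (sqrt_pos_spec _ Hm) as [Hs _].
  unfold lagrangian_x, lagrangian_y, lagrangian_p, lagrangian_q.
  repeat split; continuity_solve; apply Rgt_not_eq; nra.
Qed.

End LagrangianContinuity.

(** * Regularity of the curvature and of the defect along a curve *)

Lemma continuous_snd_comp (h : R -> R) (s t : R) :
  continuous h t -> continuous (fun z : R * R => h (snd z)) (s, t).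
Proof. intros Hh. apply (continuous_comp snd h); [apply continuous_snd | exact Hh]. Qed.

Lemma C2_on_at (a b : R) (f : R -> R) (t : R) :
  C2_on a b f -> a <= t <= b ->
  ex_derive f t /\ continuous f t /\ ex_derive (Derive f) t /\
  continuous (Derive f) t /\ continuous (Derive (Derive f)) t.
Proof.
  intros Hf Ht. destruct (locally_singleton _ _ (Hf t Ht)) as (E1 & E2 & E3).
  repeat split; try assumption; now apply (ex_derive_continuous (V := R_NormedModule)).
Qed.

Lemma regular_curve_speed2 (a b : R) (u v : R -> R) (t : R) :
  regular_curve a b u v -> a <= t <= b -> 0 < speed2 u v t.
Proof.
  intros (_ & _ & _ & Hne) Ht. unfold speed2.
  destruct (Req_dec (Derive u t) 0) as [E1|E1]; [|nra].
  destruct (Req_dec (Derive v t) 0) as [E2|E2]; [|nra].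
  exfalso. apply (Hne t Ht). now rewrite E1, E2.
Qed.

Lemma continuous_kappa_h (a b : R) (u v : R -> R) (t : R) :
  regular_curve a b u v -> a <= t <= b -> continuous (kappa_h u v) t.
Proof.
  intros Hreg Ht. pose proof (regular_curve_speed2 _ _ _ _ _ Hreg Ht) as Hm.
  destruct Hreg as (Cu & Cv & Hpos & _).
  destruct (C2_on_at _ _ _ _ Cu Ht) as (_ & U0 & _ & U1 & U2).
  destruct (C2_on_at _ _ _ _ Cv Ht) as (_ & V0 & _ & V1 & V2).
  destruct (sqrt_pos_spec _ Hm) as [Hs _].
  unfold kappa_h, speed2 in *. continuity_solve; [now apply pow_nonzero, Rgt_not_eq | lra].
Qed.

Lemma continuous_catenary_defect (lam a b : R) (u v : R -> R) (t : R) :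
  regular_curve a b u v -> a <= t <= b -> continuous (catenary_defect lam u v) t.
Proof.
  intros Hreg Ht. pose proof (regular_curve_speed2 _ _ _ _ _ Hreg Ht) as Hm.
  pose proof (continuous_kappa_h _ _ _ _ _ Hreg Ht) as Ck.
  destruct Hreg as (Cu & Cv & Hpos & _). destruct (Hpos t Ht) as [Hu Hv].
  destruct (C2_on_at _ _ _ _ Cu Ht) as (_ & U0 & _ & U1 & U2).
  destruct (C2_on_at _ _ _ _ Cv Ht) as (_ & V0 & _ & V1 & V2).
  destruct (sqrt_pos_spec _ Hm) as [Hs _].
  destruct (sqrt_pos_spec (u t ^ 2 + v t ^ 2)) as [Hr _]; [nra|].
  unfold catenary_defect, radius. unfold speed2 in *. continuity_solve.
  apply Rgt_not_eq. nra.
Qed.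

(** * The first variation of the energy *)

Lemma Derive_perturbation (f g : R -> R) (s t : R) :
  ex_derive f t -> ex_derive g t ->
  Derive (fun x => f x + s * g x) t = Derive f t + s * Derive g t.
Proof.
  intros Hf Hg. rewrite (Derive_plus f (fun x => s * g x)); [now rewrite Derive_scal | exact Hf |].
  now apply (ex_derive_scal g s t).
Qed.

(** Differentiation under the integral sign, then integration by parts. The boundary terms vanish
    with [phi] and [psi]; what remains is the normal part of the variation weighted by the
    defect. *)
Lemma first_variation (lam a b : R) (u v phi psi : R -> R) :
  a < b -> regular_curve a b u v -> C2_on a b phi -> C2_on a b psi ->
  phi a = 0 -> phi b = 0 -> psi a = 0 -> psi b = 0 ->
  is_derive (fun s => energy lam a b (fun t => u t + s * phi t) (fun t => v t + s * psi t)) 0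
    (RInt (fun t => catenary_defect lam u v t / v t ^ 2 *
                    (Derive v t * phi t - Derive u t * psi t)) a b).
Proof.
  intros Hab Hreg Cphi Cpsi phia phib psia psib.
  pose proof (fun t Ht => regular_curve_speed2 _ _ _ _ t Hreg Ht) as Hm.
  pose proof (fun t Ht => continuous_catenary_defect lam _ _ _ _ t Hreg Ht) as Cdef.
  destruct Hreg as (Cu & Cv & Hpos & _).
  pose proof (fun t => C2_on_at _ _ _ t Cu) as Cu'.
  pose proof (fun t => C2_on_at _ _ _ t Cv) as Cv'.
  pose proof (fun t => C2_on_at _ _ _ t Cphi) as Cphi'.
  pose proof (fun t => C2_on_at _ _ _ t Cpsi) as Cpsi'.
  clear Cu Cv Cphi Cpsi.
  set (x := fun s t => u t + s * phi t). set (y := fun s t => v t + s * psi t).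
  set (p := fun s t => Derive u t + s * Derive phi t).
  set (q := fun s t => Derive v t + s * Derive psi t).
  set (F := fun s t => lagrangian lam (x s t) (y s t) (p s t) (q s t)).
  set (dF := fun s t =>
    lagrangian_x (x s t) (y s t) (p s t) (q s t) * phi t +
    lagrangian_y lam (x s t) (y s t) (p s t) (q s t) * psi t +
    lagrangian_p lam (x s t) (y s t) (p s t) (q s t) * Derive phi t +
    lagrangian_q lam (x s t) (y s t) (p s t) (q s t) * Derive psi t).
  (* The region where the closed forms of the partial derivatives are valid. *)
  set (admissible := fun s t => 0 < x s t /\ 0 < y s t /\ 0 < p s t ^ 2 + q s t ^ 2).
  assert (Hx0 : forall t, x 0 t = u t) by (intros; unfold x; ring).
  assert (Hy0 : forall t, y 0 t = v t) by (intros; unfold y; ring).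
  assert (Hp0 : forall t, p 0 t = Derive u t) by (intros; unfold p; ring).
  assert (Hq0 : forall t, q 0 t = Derive v t) by (intros; unfold q; ring).
  assert (Hadm0 : forall t, a <= t <= b -> admissible 0 t).
  { intros t Ht. unfold admissible. rewrite Hx0, Hy0, Hp0, Hq0.
    destruct (Hpos t Ht). repeat split; [assumption | assumption | exact (Hm t Ht)]. }
  assert (HdF : forall s t, admissible s t -> is_derive (fun s => F s t) s (dF s t)).
  { intros s t (Hx & Hy & Hpq).
    refine (is_derive_lagrangian lam (fun s => x s t) (fun s => y s t)
      (fun s => p s t) (fun s => q s t) s _ _ _ _ _ _ _ _ Hx Hy Hpq);
      unfold x, y, p, q; auto_derive; auto; ring. }
  assert (Hperturb : forall (f g : R -> R) (s t : R), continuous f t -> continuous g t ->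
    continuous (fun z : R * R => f (snd z) + fst z * g (snd z)) (s, t)).
  { intros f g s t Hf Hg.
    pose proof (continuous_snd_comp f s t Hf). pose proof (continuous_snd_comp g s t Hg).
    apply continuous_Rplus; [auto|]. apply continuous_Rmult; [apply continuous_fst | auto]. }
  assert (Hcont : forall s t, a <= t <= b ->
    continuous (fun z : R * R => x (fst z) (snd z)) (s, t) /\
    continuous (fun z : R * R => y (fst z) (snd z)) (s, t) /\
    continuous (fun z : R * R => p (fst z) (snd z)) (s, t) /\
    continuous (fun z : R * R => q (fst z) (snd z)) (s, t)).
  { intros s t Ht.
    destruct (Cu' t Ht) as (_ & U0 & _ & U1 & _). destruct (Cv' t Ht) as (_ & V0 & _ & V1 & _).
    destruct (Cphi' t Ht) as (_ & P0 & _ & P1 & _).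
    destruct (Cpsi' t Ht) as (_ & Q0 & _ & Q1 & _).
    unfold x, y, p, q. repeat split; now apply Hperturb. }
  assert (Hcont1 : forall s t, a <= t <= b ->
    continuous (x s) t /\ continuous (y s) t /\ continuous (p s) t /\ continuous (q s) t).
  { intros s t Ht.
    destruct (Cu' t Ht) as (_ & U0 & _ & U1 & _). destruct (Cv' t Ht) as (_ & V0 & _ & V1 & _).
    destruct (Cphi' t Ht) as (_ & P0 & _ & P1 & _).
    destruct (Cpsi' t Ht) as (_ & Q0 & _ & Q1 & _).
    unfold x, y, p, q. repeat split; continuity_solve. }
  assert (Hadm : forall t, a <= t <= b -> locally_2d admissible 0 t).
  { intros t Ht. apply locally_2d_locally.
    destruct (Hcont 0 t Ht) as (C1 & C2 & C3 & C4). destruct (Hadm0 t Ht) as (H1 & H2 & H3).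
    apply filter_and; [|apply filter_and].
    - exact (locally_continuous_pos _ (0, t) C1 H1).
    - exact (locally_continuous_pos _ (0, t) C2 H2).
    - apply (locally_continuous_pos
        (fun z : R * R => p (fst z) (snd z) ^ 2 + q (fst z) (snd z) ^ 2) (0, t)); [|exact H3].
      continuity_solve. }
  pose proof (locally_2d_tube admissible 0 a b Hadm) as Htube.
  apply (is_derive_ext (fun s => RInt (F s) a b)).
  { intros s. unfold energy. apply RInt_ext. intros t.
    rewrite Rmin_left, Rmax_right by lra. intros Ht.
    assert (Ht' : a <= t <= b) by lra.
    unfold F, lagrangian, speed2.
    rewrite (Derive_perturbation u phi), (Derive_perturbation v psi); [reflexivity | | | |].
    - now apply Cv'.
    - now apply Cpsi'.
    - now apply Cu'.
    - now apply Cphi'. }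
  assert (Hend : RInt (fun t => Derive (fun s => F s t) 0) a b =
    RInt (fun t => catenary_defect lam u v t / v t ^ 2 *
                    (Derive v t * phi t - Derive u t * psi t)) a b).
  { set (E := fun t => catenary_defect lam u v t / v t ^ 2 *
                    (Derive v t * phi t - Derive u t * psi t)).
    assert (CE : forall t, a <= t <= b -> continuous E t).
    { intros t Ht. destruct (Hpos t Ht) as [_ Hv]. pose proof (Cdef t Ht).
      destruct (Cu' t Ht) as (_ & U0 & _ & U1 & _). destruct (Cv' t Ht) as (_ & V0 & _ & V1 & _).
      destruct (Cphi' t Ht) as (_ & P0 & _ & P1 & _).
      destruct (Cpsi' t Ht) as (_ & Q0 & _ & Q1 & _).
      unfold E. continuity_solve. apply Rgt_not_eq. nra. }
    assert (CdF : forall t, a <= t <= b -> continuous (dF 0) t).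
    { intros t Ht. destruct (Hcont1 0 t Ht) as (C1 & C2 & C3 & C4).
      destruct (Hadm0 t Ht) as (H1 & H2 & H3).
      destruct (Cphi' t Ht) as (_ & P0 & _ & P1 & _).
      destruct (Cpsi' t Ht) as (_ & Q0 & _ & Q1 & _).
      destruct (continuous_lagrangian_partials lam _ _ _ _ t C1 C2 C3 C4 H1 H2 H3)
        as (K1 & K2 & K3 & K4).
      unfold dF. continuity_solve. }
    (* [W] is the boundary term of the integration by parts: its derivative is [dF 0 - E], and it
       vanishes at [a] and [b]. *)
    set (W := fun t => along (lagrangian_p lam) u v t * phi t +
                       along (lagrangian_q lam) u v t * psi t).
    assert (HW : forall t, a <= t <= b -> is_derive W t (dF 0 t - E t)).
    { intros t Ht. destruct (Hpos t Ht) as [Hu Hv].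
      destruct (Cu' t Ht) as (U0 & _ & U1 & _). destruct (Cv' t Ht) as (V0 & _ & V1 & _).
      destruct (Cphi' t Ht) as (P0 & _). destruct (Cpsi' t Ht) as (Q0 & _).
      destruct (euler_lagrange_pq lam u v t U0 V0 U1 V1 Hu Hv (Hm t Ht)) as [DP DQ].
      unfold W. auto_derive; [repeat split; try assumption; eexists; eassumption|].
      rewrite (Derive_eta _ _ _ DP), (Derive_eta _ _ _ DQ).
      unfold dF, E. rewrite Hx0, Hy0, Hp0, Hq0. unfold along.
      change (Derive (fun x => phi x) t) with (Derive phi t).
      change (Derive (fun x => psi x) t) with (Derive psi t).
      field. lra. }
    assert (IW : is_RInt (fun t => dF 0 t - E t) a b (minus (W b) (W a))).
    { apply (is_RInt_derive (V := R_CompleteNormedModule) W); intros t;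
        rewrite Rmin_left, Rmax_right by lra; intros Ht.
      - now apply HW.
      - apply continuous_Rminus; auto. }
    assert (IE : is_RInt E a b (RInt E a b)).
    { apply (RInt_correct E). apply ex_RInt_continuous_le; [lra | exact CE]. }
    apply is_RInt_unique.
    replace (RInt E a b) with (plus (minus (W b) (W a)) (RInt E a b));
      [|unfold W, minus, plus, opp; simpl; rewrite phia, phib, psia, psib; ring].
    refine (is_RInt_ext _ _ _ _ _ _ (is_RInt_plus _ _ _ _ _ _ IW IE)).
    intros t. rewrite Rmin_left, Rmax_right by lra. intros Ht.
    transitivity (dF 0 t); [unfold plus; simpl; ring|].
    symmetry. apply is_derive_unique, HdF, Hadm0. lra. }
  rewrite <- Hend.
  (* Three conditions remain: differentiability in [s] near 0, joint continuity of the
     [s]-derivative at [(0, t)], and integrability in [t] for [s] near 0. The first and the last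
     rest on the tube. *)
  apply is_derive_RInt_param.
  - revert Htube. apply filter_imp. intros s Hs t.
    rewrite Rmin_left, Rmax_right by lra. intros Ht. eexists. apply HdF. now apply Hs.
  - intros t. rewrite Rmin_left, Rmax_right by lra. intros Ht.
    apply (continuity_2d_pt_ext_loc dF).
    + generalize (Hadm t Ht). intros [d Hd]. exists d. intros s t' Hs Ht'.
      symmetry. apply is_derive_unique, HdF. now apply Hd.
    + apply continuity_2d_pt_filterlim.
      destruct (Hcont 0 t Ht) as (C1 & C2 & C3 & C4). destruct (Hadm0 t Ht) as (H1 & H2 & H3).
      destruct (continuous_lagrangian_partials lam _ _ _ _ (0, t) C1 C2 C3 C4 H1 H2 H3)
        as (K1 & K2 & K3 & K4).
      destruct (Cphi' t Ht) as (_ & P0 & _ & P1 & _).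
      destruct (Cpsi' t Ht) as (_ & Q0 & _ & Q1 & _).
      apply (continuous_snd_comp _ 0) in P0, P1, Q0, Q1.
      change (continuous (fun z : R * R => dF (fst z) (snd z)) (0, t)).
      unfold dF. continuity_solve.
  - revert Htube. apply filter_imp. intros s Hs.
    apply ex_RInt_continuous_le; [lra|]. intros t Ht.
    destruct (Hcont1 s t Ht) as (C1 & C2 & C3 & C4). destruct (Hs t Ht) as (H1 & H2 & H3).
    now apply continuous_lagrangian.
Qed.

(** Horizontal and vertical variations, tested separately, give [N v' = 0] and [N u' = 0] for the
    defect [N]; by regularity [N = 0]. Conversely, a zero defect annihilates the integrand of the
    first variation. *)
Lemma hyperbolic_catenary_iff_defect (lam a b : R) (u v : R -> R) :
  a < b -> regular_curve a b u v ->
  hyperbolic_catenary lam a b u v <->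
  (forall t, a <= t <= b -> catenary_defect lam u v t = 0).
Proof.
  intros Hab Hreg.
  pose proof (first_variation lam a b u v) as Hvar.
  split.
  - intros Hcat.
    pose proof (fun t Ht => continuous_catenary_defect lam _ _ _ _ t Hreg Ht) as Cdef.
    pose proof (fun t Ht => regular_curve_speed2 _ _ _ _ t Hreg Ht) as Hm.
    assert (Hzero : C2_on a b (fun _ => 0)).
    { intros t _. apply filter_forall. intros x.
      assert (E : forall y, Derive (fun _ => 0) y = 0) by (intros; apply Derive_const).
      repeat split.
      - apply ex_derive_const.
      - apply (ex_derive_ext (fun _ => 0)); [now intros; rewrite E | apply ex_derive_const].
      - apply (continuous_ext (fun _ => 0)); [|apply continuous_const].
        intros y. rewrite (Derive_ext _ (fun _ => 0) y E). now rewrite E. }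
    assert (Hc : forall t, a <= t <= b ->
      continuous (Derive u) t /\ continuous (Derive v) t /\ continuous v t /\ 0 < v t ^ 2).
    { intros t Ht. destruct Hreg as (Cu & Cv & Hpos & _). destruct (Hpos t Ht) as [_ Hv].
      destruct (C2_on_at _ _ _ _ Cu Ht) as (_ & _ & _ & U1 & _).
      destruct (C2_on_at _ _ _ _ Cv Ht) as (_ & V0 & _ & V1 & _).
      repeat split; try assumption. nra. }
    assert (Eu : forall t, a <= t <= b -> catenary_defect lam u v t / v t ^ 2 * Derive v t = 0).
    { apply (fundamental_lemma_C2 a b); [exact Hab | |].
      - intros t Ht. pose proof (Cdef t Ht). destruct (Hc t Ht) as (U1 & V1 & V0 & Hv).
        continuity_solve. lra.
      - intros phi Cphi pa pb.
        (* The hypothesis and the variation formula give two values of the same derivative at 0,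
           which must agree. *)
        refine (eq_trans _ (is_derive_unique _ _ _
          (Hcat phi (fun _ => 0) Cphi Hzero pa pb eq_refl eq_refl))).
        refine (eq_trans _ (eq_sym (is_derive_unique _ _ _
          (Hvar phi (fun _ => 0) Hab Hreg Cphi Hzero pa pb eq_refl eq_refl)))).
        apply RInt_ext. intros t _. simpl. ring. }
    assert (Ev : forall t, a <= t <= b -> catenary_defect lam u v t / v t ^ 2 * Derive u t = 0).
    { apply (fundamental_lemma_C2 a b); [exact Hab | |].
      - intros t Ht. pose proof (Cdef t Ht). destruct (Hc t Ht) as (U1 & V1 & V0 & Hv).
        continuity_solve. lra.
      - intros psi Cpsi pa pb.
        (* The first variation carries [- u' psi], so the test function is [- psi]. *)
        assert (Cpsi' : C2_on a b (fun t => - psi t)).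
        { intros t Ht. generalize (locally_locally _ _ (Cpsi t Ht)). apply filter_imp.
          intros x Hx. pose proof (locally_singleton _ _ Hx) as (P0 & P1 & P2).
          assert (E1 : forall y, Derive (fun t => - psi t) y = - Derive psi y)
            by (intros; apply Derive_opp).
          assert (E2 : forall y, Derive (Derive (fun t => - psi t)) y = - Derive (Derive psi) y).
          { intros y. rewrite (Derive_ext _ _ y E1). apply Derive_opp. }
          repeat split.
          - now apply (ex_derive_opp psi).
          - apply (ex_derive_ext (fun y => - Derive psi y)); [now intros; rewrite E1|].
            now apply (ex_derive_opp (Derive psi)).
          - apply (continuous_ext (fun y => - Derive (Derive psi) y)); [now intros; rewrite E2|].
            now apply continuous_Ropp. }
        assert (pa' : - psi a = 0) by (rewrite pa; ring).
        assert (pb' : - psi b = 0) by (rewrite pb; ring).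
        refine (eq_trans _ (is_derive_unique _ _ _
          (Hcat (fun _ => 0) (fun t => - psi t) Hzero Cpsi' eq_refl eq_refl pa' pb'))).
        refine (eq_trans _ (eq_sym (is_derive_unique _ _ _
          (Hvar (fun _ => 0) (fun t => - psi t) Hab Hreg Hzero Cpsi' eq_refl eq_refl pa' pb')))).
        apply RInt_ext. intros t _. simpl. ring. }
    intros t Ht. specialize (Eu t Ht). specialize (Ev t Ht). specialize (Hm t Ht).
    destruct (Hc t Ht) as (_ & _ & _ & Hv). unfold speed2 in Hm.
    set (X := catenary_defect lam u v t / v t ^ 2) in *.
    assert (E : X = 0).
    { apply (Rmult_eq_reg_r (Derive u t ^ 2 + Derive v t ^ 2)); [|lra].
      transitivity (X * Derive u t * Derive u t + X * Derive v t * Derive v t); [ring|].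
      rewrite Eu, Ev. ring. }
    transitivity (X * v t ^ 2); [unfold X; field; nra | rewrite E; ring].
  - intros Hdef phi psi Cphi Cpsi pa pb qa qb.
    replace 0 with (RInt (fun t => catenary_defect lam u v t / v t ^ 2 *
                    (Derive v t * phi t - Derive u t * psi t)) a b) at 2.
    { now apply Hvar. }
    rewrite (RInt_ext _ (fun _ => 0)).
    { rewrite RInt_const. exact (Rmult_0_r (b - a)). }
    intros t. rewrite Rmin_left, Rmax_right by lra. intros Ht.
    rewrite Hdef by lra. unfold Rdiv. rewrite !Rmult_0_l. reflexivity.
Qed.

(** * The dilation integral, and arcs along which [kappa_h] or [d + lam] vanishes *)

(* Noether's first integral for the dilations [(x, y) |-> (k x, k y)], which are
   isometries preserving [dist_L].  Once it vanishes, so does [r'] wherever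
   [dist_L + lam] does not. *)
Lemma catenary_dilation_integral (lam a b : R) (u v : R -> R) (s t : R) :
  regular_curve a b u v ->
  (forall t, a <= t <= b -> catenary_defect lam u v t = 0) ->
  a <= s -> s < t -> t <= b ->
  u s * along (lagrangian_p lam) u v s + v s * along (lagrangian_q lam) u v s =
  u t * along (lagrangian_p lam) u v t + v t * along (lagrangian_q lam) u v t.
Proof.
  intros Hreg Hdef Has Hst Htb.
  apply (eq_is_derive
    (fun x => u x * along (lagrangian_p lam) u v x + v x * along (lagrangian_q lam) u v x) s t);
    [|exact Hst].
  intros x Hx. assert (Hx' : a <= x <= b) by lra.
  pose proof (regular_curve_speed2 _ _ _ _ _ Hreg Hx') as Hm.
  destruct Hreg as (Cu & Cv & Hpos & _). destruct (Hpos x Hx') as [Hu Hv].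
  destruct (C2_on_at _ _ _ _ Cu Hx') as (U0 & _ & U1 & _).
  destruct (C2_on_at _ _ _ _ Cv Hx') as (V0 & _ & V1 & _).
  destruct (euler_lagrange_pq lam u v x U0 V0 U1 V1 Hu Hv Hm) as [DP DQ].
  rewrite (Hdef x Hx') in DP, DQ.
  auto_derive; [repeat split; try assumption; eexists; eassumption|].
  rewrite (Derive_eta _ _ _ DP), (Derive_eta _ _ _ DQ).
  rewrite (Derive_eta _ _ _ (Derive_correct _ _ U0)), (Derive_eta _ _ _ (Derive_correct _ _ V0)).
  (* What remains is infinitesimal dilation invariance: with [L] the Lagrangian,
     [x L_x + y L_y + p L_p + q L_q = 0]. *)
  unfold along, lagrangian_x, lagrangian_y, lagrangian_p, lagrangian_q, zero; simpl.
  unfold speed2 in Hm.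
  destruct (sqrt_pos_spec (u x ^ 2 + v x ^ 2)) as [Hr Hrr]; [nra|].
  destruct (sqrt_pos_spec _ Hm) as [Hs Hss].
  simpl in *.
  set (r := sqrt (u x * (u x * 1) + v x * (v x * 1))) in *.
  set (m := sqrt (Derive u x * (Derive u x * 1) + Derive v x * (Derive v x * 1))) in *.
  assert (Hss' : m ^ 2 = Derive u x ^ 2 + Derive v x ^ 2) by lra.
  field [Hss']. repeat split; lra.
Qed.

(** The first integral equals [(d + lam) (u u' + v v') / (v |gamma'|)]; it is zero at [t0], hence
    everywhere. Where [d + lam] is nonzero it divides out; where it is zero, the vanishing defect is
    itself the claim up to a nonzero factor. *)
Lemma catenary_crossing_orthogonal (lam a b : R) (u v : R -> R) (t0 : R) :
  a < b -> regular_curve a b u v ->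
  (forall t, a <= t <= b -> catenary_defect lam u v t = 0) ->
  a <= t0 <= b -> dist_L (u t0) (v t0) + lam = 0 ->
  forall t, a <= t <= b -> u t * Derive u t + v t * Derive v t = 0.
Proof.
  intros Hab Hreg Hdef Ht0 Hd0 t Ht.
  set (J := fun x => u x * along (lagrangian_p lam) u v x + v x * along (lagrangian_q lam) u v x).
  assert (HJ0 : J t0 = 0).
  { unfold J, along, lagrangian_p, lagrangian_q. rewrite Hd0. unfold Rdiv. ring. }
  assert (HJ : J t = 0).
  { destruct (Rtotal_order t t0) as [H|[H|H]].
    - rewrite <- HJ0. apply (catenary_dilation_integral lam a b); auto; lra.
    - now rewrite H.
    - rewrite <- HJ0. symmetry. apply (catenary_dilation_integral lam a b); auto; lra. }
  specialize (Hdef t Ht).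
  pose proof (regular_curve_speed2 _ _ _ _ _ Hreg Ht) as Hm.
  destruct Hreg as (_ & _ & Hpos & _). destruct (Hpos t Ht) as [Hu Hv].
  unfold J, along, lagrangian_p, lagrangian_q in HJ.
  unfold catenary_defect, radius, speed2 in *.
  destruct (sqrt_pos_spec (u t ^ 2 + v t ^ 2)) as [Hr Hrr]; [nra|].
  destruct (sqrt_pos_spec _ Hm) as [Hs Hss].
  set (r := sqrt (u t ^ 2 + v t ^ 2)) in *.
  set (m := sqrt (Derive u t ^ 2 + Derive v t ^ 2)) in *.
  set (D := dist_L (u t) (v t) + lam) in *.
  destruct (Req_dec D 0) as [HD|HD].
  - rewrite HD, Rmult_0_l, Rplus_0_l in Hdef.
    apply Rmult_integral in Hdef. destruct Hdef as [H|H]; [exact H|].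
    exfalso. revert H. apply Rinv_neq_0_compat, Rgt_not_eq. nra.
  - assert (E : D * (u t * Derive u t + v t * Derive v t) = 0).
    { replace (D * (u t * Derive u t + v t * Derive v t)) with
        ((u t * (D * Derive u t / (v t * m)) + v t * (D * Derive v t / (v t * m))) * (v t * m))
        by (field; lra).
      rewrite HJ. ring. }
    apply Rmult_integral in E. tauto.
Qed.

(** The radius is constant, so the curve runs along a Euclidean half-circle centred at the origin, a
    geodesic. The relation is differentiated on the open interval, and continuity covers the
    endpoints. *)
Lemma kappa_h_orthogonal (a b : R) (u v : R -> R) (t : R) :
  a < b -> regular_curve a b u v ->
  (forall t, a <= t <= b -> u t * Derive u t + v t * Derive v t = 0) ->
  a <= t <= b -> kappa_h u v t = 0.
Proof.
  intros Hab Hreg Horth Ht. revert t Ht.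
  apply continuous_eq0_closure; [exact Hab | intros; now apply (continuous_kappa_h a b)|].
  intros t Ht. assert (Ht' : a <= t <= b) by lra.
  pose proof (regular_curve_speed2 _ _ _ _ _ Hreg Ht') as Hm.
  destruct Hreg as (Cu & Cv & Hpos & _). destruct (Hpos t Ht') as [Hu Hv].
  destruct (C2_on_at _ _ _ _ Cu Ht') as (U0 & _ & U1 & _).
  destruct (C2_on_at _ _ _ _ Cv Ht') as (V0 & _ & V1 & _).
  apply Derive_correct in U0, V0, U1, V1.
  assert (E : Derive u t * Derive u t + u t * Derive (Derive u) t +
              (Derive v t * Derive v t + v t * Derive (Derive v) t) = 0).
  { apply (is_derive_locally0 (fun t => u t * Derive u t + v t * Derive v t) a b t);
      [intros; apply Horth; lra | exact Ht |].
    apply (is_derive_plus (fun t => u t * Derive u t) (fun t => v t * Derive v t));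
      refine (is_derive_mult _ _ _ _ _ _ _ Rmult_comm); assumption. }
  specialize (Horth t Ht'). unfold kappa_h, speed2 in *.
  destruct (sqrt_pos_spec _ Hm) as [Hs Hss].
  set (m := sqrt (Derive u t ^ 2 + Derive v t ^ 2)) in *.
  set (p := Derive u t) in *. set (q := Derive v t) in *.
  set (p' := Derive (Derive u) t) in *. set (q' := Derive (Derive v) t) in *.
  (* Substituting [v * q'] and [v * q] from the differentiated and the original relation cancels the
     terms in [u * p']. *)
  assert (E2 : v t * (p * q' - p' * q) = - p * m ^ 2).
  { rewrite Hss. replace (v t * (p * q' - p' * q)) with (p * (v t * q') - p' * (v t * q)) by ring.
    replace (v t * q') with (- (p * p + u t * p' + q * q)) by lra.
    replace (v t * q) with (- (u t * p)) by lra. ring. }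
  replace (v t * ((p * q' - p' * q) / m ^ 3)) with (v t * (p * q' - p' * q) / m ^ 3)
    by (unfold Rdiv; ring).
  rewrite E2. field. lra.
Qed.

(* A curve at constant distance from [L] is a Euclidean ray, hence curved. *)
Lemma kappa_h_equidistant (lam a b : R) (u v : R -> R) (t : R) :
  regular_curve a b u v ->
  (forall t, a < t < b -> dist_L (u t) (v t) + lam = 0) ->
  a < t < b -> kappa_h u v t <> 0.
Proof.
  intros Hreg Hd Ht.
  (* Constant distance means constant [u / v], so the velocity is parallel to [(u, v)]. *)
  assert (Hray : forall x, a < x < b -> Derive u x * v x - u x * Derive v x = 0).
  { intros x Hx. assert (Hx' : a <= x <= b) by lra.
    destruct Hreg as (Cu & Cv & Hpos & _). destruct (Hpos x Hx') as [Hu Hv].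
    destruct (C2_on_at _ _ _ _ Cu Hx') as (U0 & _). destruct (C2_on_at _ _ _ _ Cv Hx') as (V0 & _).
    apply Derive_correct in U0, V0.
    pose proof (is_derive_dist_L u v x _ _ U0 V0 Hu Hv) as DD.
    destruct (sqrt_pos_spec (u x ^ 2 + v x ^ 2)) as [Hr _]; [nra|].
    assert (E : (Derive u x - u x / v x * Derive v x) / sqrt (u x ^ 2 + v x ^ 2) = 0).
    { apply (is_derive_locally0 (fun x => dist_L (u x) (v x) + lam) a b x); [exact Hd | exact Hx|].
      rewrite <- Rplus_0_r.
      exact (is_derive_plus _ _ _ _ _ DD (is_derive_const lam x)). }
    set (r := sqrt (u x ^ 2 + v x ^ 2)) in *.
    replace (Derive u x * v x - u x * Derive v x) with
      ((Derive u x - u x / v x * Derive v x) / r * (r * v x)) by (field; lra).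
    rewrite E. ring. }
  assert (Ht' : a <= t <= b) by lra.
  pose proof (regular_curve_speed2 _ _ _ _ _ Hreg Ht') as Hm.
  destruct Hreg as (Cu & Cv & Hpos & _). destruct (Hpos t Ht') as [Hu Hv].
  destruct (C2_on_at _ _ _ _ Cu Ht') as (U0 & _ & U1 & _).
  destruct (C2_on_at _ _ _ _ Cv Ht') as (V0 & _ & V1 & _).
  apply Derive_correct in U0, V0, U1, V1.
  assert (E : Derive (Derive u) t * v t + Derive u t * Derive v t -
              (Derive u t * Derive v t + u t * Derive (Derive v) t) = 0).
  { apply (is_derive_locally0 (fun t => Derive u t * v t - u t * Derive v t) a b t);
      [exact Hray | exact Ht |].
    apply (is_derive_minus (fun t => Derive u t * v t) (fun t => u t * Derive v t));
      refine (is_derive_mult _ _ _ _ _ _ _ Rmult_comm); assumption. }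
  specialize (Hray t Ht). unfold kappa_h, speed2 in *.
  destruct (sqrt_pos_spec _ Hm) as [Hs Hss].
  set (m := sqrt (Derive u t ^ 2 + Derive v t ^ 2)) in *.
  set (p := Derive u t) in *. set (q := Derive v t) in *.
  set (p' := Derive (Derive u) t) in *. set (q' := Derive (Derive v) t) in *.
  (* By [Hray] and its derivative, velocity and acceleration are both parallel to [(u, v)], hence to
     each other. *)
  assert (E2 : p * q' - p' * q = 0).
  { apply (Rmult_eq_reg_r (u t)); [|lra].
    replace ((p * q' - p' * q) * u t) with (p * (u t * q') - p' * (u t * q)) by ring.
    replace (u t * q') with (p' * v t) by lra. replace (u t * q) with (p * v t) by lra. ring. }
  (* Only [p / m] is left of the curvature; [p = 0] forces [q = 0] through [Hray], against
     regularity. *)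
  rewrite E2. intros H.
  assert (Hp : p = 0).
  { replace p with ((v t * (0 / m ^ 3) + p / m) * m) by (field; lra). rewrite H. ring. }
  assert (Hq : q = 0) by (rewrite Hp in Hray; nra).
  rewrite Hp, Hq in Hm. lra.
Qed.

(** * The curvature formula *)

Lemma Derive_radius (u v : R -> R) (t : R) :
  ex_derive u t -> ex_derive v t -> 0 < u t -> 0 < v t ->
  Derive (radius u v) t = (u t * Derive u t + v t * Derive v t) / radius u v t.
Proof.
  intros Hu Hv Pu Pv. destruct (sqrt_pos_spec (u t ^ 2 + v t ^ 2)) as [Hr _]; [nra|].
  apply Derive_correct in Hu, Hv.
  apply is_derive_unique. unfold radius. auto_derive.
  - repeat split; first [now eexists; eassumption | nra].
  - rewrite (Derive_eta _ _ _ Hu), (Derive_eta _ _ _ Hv).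
    set (r := sqrt (u t ^ 2 + v t ^ 2)) in *.
    change (sqrt (u t * (u t * 1) + v t * (v t * 1))) with r. field. lra.
Qed.

Theorem theorem3p4 (lam a b : R) (u v : R -> R) (hab : a < b)
  (hreg : regular_curve a b u v) :
  hyperbolic_catenary lam a b u v <->
  (forall t, a <= t <= b ->
     let d := ln ((u t + radius u v t) / v t) in
     kappa_h u v t =
       - (1 / (d + lam)) *
         ((u t * Derive u t + v t * Derive v t) /
          (sqrt (u t ^ 2 + v t ^ 2) * sqrt (Derive u t ^ 2 + Derive v t ^ 2)))
     /\
     - (1 / (d + lam)) *
         ((u t * Derive u t + v t * Derive v t) /
          (sqrt (u t ^ 2 + v t ^ 2) * sqrt (Derive u t ^ 2 + Derive v t ^ 2)))
     = - (Derive (radius u v) t /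
          ((d + lam) * sqrt (Derive u t ^ 2 + Derive v t ^ 2)))).
Proof.
  rewrite (hyperbolic_catenary_iff_defect lam a b u v hab hreg).
  split.
  - intros Hdef t Ht. cbv zeta.
    change (ln ((u t + radius u v t) / v t)) with (dist_L (u t) (v t)).
    pose proof (Hdef t Ht) as Hdt. unfold catenary_defect in Hdt.
    change (sqrt (u t ^ 2 + v t ^ 2)) with (radius u v t).
    change (Derive u t ^ 2 + Derive v t ^ 2) with (speed2 u v t).
    split.
    + destruct (Req_dec (dist_L (u t) (v t) + lam) 0) as [HD|HD].
      (* Both sides are zero: the left because the catenary is a geodesic, the right because
         [/ 0 = 0]. *)
      * rewrite (kappa_h_orthogonal a b u v t hab hreg
          (catenary_crossing_orthogonal lam a b u v t hab hreg Hdef Ht HD) Ht).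
        rewrite HD. unfold Rdiv. rewrite Rinv_0. ring.
      * apply (Rmult_eq_reg_l (dist_L (u t) (v t) + lam)); [|exact HD].
        set (X := (u t * Derive u t + v t * Derive v t) / (radius u v t * sqrt (speed2 u v t))) in *.
        replace ((dist_L (u t) (v t) + lam) * (- (1 / (dist_L (u t) (v t) + lam)) * X))
          with (- X) by (field; exact HD).
        lra.
    + destruct hreg as (Cu & Cv & Hpos & _). destruct (Hpos t Ht) as [Hu Hv].
      destruct (C2_on_at _ _ _ _ Cu Ht) as (U0 & _). destruct (C2_on_at _ _ _ _ Cv Ht) as (V0 & _).
      rewrite (Derive_radius u v t U0 V0 Hu Hv).
      (* No case split on [d + lam]: the inverse of a product is the product of the inverses even at
         0. *)
      unfold Rdiv. rewrite !Rinv_mult. ring.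
  - (* Where [d + lam = 0] the formula says [kappa_h = 0] by the junk value [1 / 0 = 0].
       A nonzero defect at [t0] would force this on a whole interval, i.e. on an
       equidistant arc, and such arcs have [kappa_h <> 0]. *)
    intros Hform t0 Ht0. apply NNPP. intros Hne.
    assert (Hloc : locally t0 (fun x => 0 < catenary_defect lam u v x ^ 2)).
    { apply locally_continuous_pos; [|now apply pow2_gt_0].
      apply continuous_Rpow. now apply (continuous_catenary_defect lam a b). }
    destruct Hloc as [eps Heps].
    destruct (interval_near a b t0 eps hab Ht0 (cond_pos eps)) as (c & d & H1 & H2 & H3 & H4).
    assert (Hbad : forall t, c <= t <= d ->
      dist_L (u t) (v t) + lam = 0 /\ kappa_h u v t = 0).
    { intros t Ht. pose proof (Heps t (H4 t Ht)) as Hnz.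
      destruct (Hform t ltac:(lra)) as [Hk _]. cbv zeta in Hk.
      change (ln ((u t + radius u v t) / v t)) with (dist_L (u t) (v t)) in Hk.
      change (sqrt (u t ^ 2 + v t ^ 2)) with (radius u v t) in Hk.
      change (Derive u t ^ 2 + Derive v t ^ 2) with (speed2 u v t) in Hk.
      destruct (Req_dec (dist_L (u t) (v t) + lam) 0) as [HD|HD].
      - split; [exact HD|]. rewrite Hk, HD. unfold Rdiv. rewrite Rinv_0. ring.
      - exfalso. unfold catenary_defect in Hnz. rewrite Hk in Hnz.
        set (X := (u t * Derive u t + v t * Derive v t) / (radius u v t * sqrt (speed2 u v t))) in *.
        replace ((dist_L (u t) (v t) + lam) * (- (1 / (dist_L (u t) (v t) + lam)) * X))
          with (- X) in Hnz by (field; exact HD).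
        replace (- X + X) with 0 in Hnz by ring. lra. }
    assert (Hsub : regular_curve c d u v).
    { destruct hreg as (Cu & Cv & Hpos & Hne').
      repeat split; try (intros t Ht; first [apply Cu | apply Cv | apply Hne']; lra);
        apply (Hpos t); lra. }
    apply (kappa_h_equidistant lam c d u v ((c + d) / 2) Hsub);
      [intros; apply Hbad; lra | lra | apply Hbad; lra].
Qed.
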